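(* Let $\mu\in V_{3,m}$ be a nonsingular $2$-step algebra of Rep-type, where the fixed inner product on $\mathfrak{n}_2$ is $\operatorname{ad}\mathfrak{n}_2$-invariant. Then $$\mathfrak{k}(\mu)/\mathfrak{k}_0(\mu)\simeq\mathfrak{so}(3).$$
   Context: Let $\mathfrak{n}=\mathfrak{n}_1\oplus\mathfrak{n}_2$ be a real inner product space with $\mathfrak{n}_1\perp\mathfrak{n}_2$, $\dim\mathfrak{n}_1=m$, $\dim\mathfrak{n}_2=n$. $V_{n,m}=\Lambda^2\mathfrak{n}_1^*\otimes\mathfrak{n}_2$ is the space of bilinear skew-symmetric maps $\mu:\mathfrak{n}_1\times\mathfrak{n}_1\to\mathfrak{n}_2$, each regarded as a $2$-step nilpotent Lie bracket on $\mathfrak{n}$ (with $\mathfrak{n}_2$ central). $J_\mu:\mathfrak{n}_2\to\mathfrak{so}(\mathfrak{n}_1)$ is defined by $\langle J_\mu(Z)X,Y\rangle=\langle\mu(X,Y),Z\rangle$. $\mu$ is nonsingular if $J_\mu(Z)$ is invertible for every nonzero $Z\in\mathfrak{n}_2$. $\mu$ is of Rep-type if $\mathfrak{n}_2$ is endowed with the structure of a compact Lie algebra, with Lie bracket $[\cdot,\cdot]$, such that $J_\mu$ is a representation: $J_\mu([Z,W])=[J_\mu(Z),J_\mu(W)]$ for all $Z,W\in\mathfrak{n}_2$. The inner product on $\mathfrak{n}_2$ is $\operatorname{ad}\mathfrak{n}_2$-invariant if $\operatorname{ad}Z:\mathfrak{n}_2\to\mathfrak{n}_2$, $W\mapsto[Z,W]$,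 is skew-symmetric for every $Z\in\mathfrak{n}_2$. Skew-symmetric derivations: $$\mathfrak{k}(\mu)=\left\{\begin{bmatrix}B&0\\0&A\end{bmatrix}: B\in\mathfrak{so}(m),\ A\in\mathfrak{so}(n),\ [B,J_\mu(Z)]=J_\mu(AZ)\ \forall Z\in\mathfrak{n}_2\right\},$$ and $\mathfrak{k}_0(\mu)$ is the ideal of elements of $\mathfrak{k}(\mu)$ with $A=0$. *)

(* Defs.v *)
From HB Require Import structures.
From mathcomp Require Import all_boot all_order all_algebra.
From mathcomp Require Import boolp classical_sets reals.

Set Implicit Arguments.
Unset Strict Implicit.
Unset Printing Implicit Defensive.

Import Order.TTheory GRing.Theory Num.Theory.
Local Open Scope ring_scope.
Local Open Scope quotient_scope.

Record is_lie_bracket (R : comNzRingType) (V : lmodType R) (br : V -> V -> V)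
    : Prop := IsLieBracket {
  lie_bilinear : bilinear_for *:%R *:%R br;
  lie_alternating : forall x, br x x = 0;
  lie_jacobi : forall x y z,
    br x (br y z) + br y (br z x) + br z (br x y) = 0
}.

Record lieAlgebra (R : comNzRingType) := LieAlgebra {
  lie_sort :> lmodType R;
  lie_br : lie_sort -> lie_sort -> lie_sort;
  lie_brP : is_lie_bracket lie_br
}.

Arguments lie_br {R l} _ _.

Definition lie_isomorphic (R : comNzRingType) (L1 L2 : lieAlgebra R) : Prop :=
  exists f : {linear L1 -> L2},
    bijective f /\ (forall x y, f (lie_br x y) = lie_br (f x) (f y)).

Section LieBracketTheory.
Variables (R : comNzRingType) (L : lieAlgebra R).
Implicit Types x y z : L.

Lemma lie_brDl x y z : lie_br (x + y) z = lie_br x z + lie_br y z.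
Proof. by have /= := (lie_bilinear (lie_brP L)).1 z 1 x y; rewrite !scale1r. Qed.

Lemma lie_brDr x y z : lie_br x (y + z) = lie_br x y + lie_br x z.
Proof. by have /= := (lie_bilinear (lie_brP L)).2 x 1 y z; rewrite !scale1r. Qed.

Lemma lie_br0l x : lie_br 0 x = 0.
Proof. by apply: (addrI (lie_br 0 x)); rewrite -lie_brDl !addr0. Qed.

Lemma lie_br0r x : lie_br x 0 = 0.
Proof. by apply: (addrI (lie_br x 0)); rewrite -lie_brDr !addr0. Qed.

Lemma lie_brZl (a : R) x y : lie_br (a *: x) y = a *: lie_br x y.
Proof.
by have /= := (lie_bilinear (lie_brP L)).1 y a x 0; rewrite lie_br0l !addr0.
Qed.

Lemma lie_brZr (a : R) x y : lie_br x (a *: y) = a *: lie_br x y.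
Proof.
by have /= := (lie_bilinear (lie_brP L)).2 x a y 0; rewrite lie_br0r !addr0.
Qed.

Lemma lie_brC x y : lie_br x y = - lie_br y x.
Proof.
apply/eqP; rewrite -addr_eq0; apply/eqP.
have := lie_alternating (lie_brP L) (x + y).
by rewrite lie_brDl !lie_brDr !(lie_alternating (lie_brP L)) add0r addr0.
Qed.

End LieBracketTheory.

Record lieSubalgebra (R : comNzRingType) (L : lieAlgebra R) := LieSubalgebra {
  lsub_pred :> {pred L};
  lsub_submod : submod_closed lsub_pred;
  lsub_br : {in lsub_pred &, forall x y, lie_br x y \in lsub_pred}
}.

Section LieSub.
Variables (R : comNzRingType) (L : lieAlgebra R) (S : lieSubalgebra L).

HB.instance Definition _ :=
  GRing.isSubmodClosed.Build R L (lsub_pred S) (lsub_submod S).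

Record lie_sub_type : Type := LieSub {
  lie_subval : L;
  lie_subvalP : lie_subval \in lsub_pred S
}.

HB.instance Definition _ := [isSub for lie_subval].
HB.instance Definition _ := [Choice of lie_sub_type by <:].
HB.instance Definition _ := [SubChoice_isSubLmodule of lie_sub_type by <:].

Definition lie_sub_br (x y : lie_sub_type) : lie_sub_type :=
  LieSub (lsub_br (lie_subvalP x) (lie_subvalP y)).

Lemma lie_sub_brP : is_lie_bracket lie_sub_br.
Proof.
split.
- split=> [z a x y|z a x y]; apply: val_inj; rewrite linearP /=.
    by rewrite lie_brDl lie_brZl.
  by rewrite lie_brDr lie_brZr.
- by move=> x; apply: val_inj; rewrite /= (lie_alternating (lie_brP L)).
- move=> x y z; apply: val_inj.
  by rewrite !raddfD /= (lie_jacobi (lie_brP L)).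
Qed.

Definition lie_sub : lieAlgebra R := LieAlgebra lie_sub_brP.

End LieSub.

Record lieIdeal (R : comNzRingType) (L : lieAlgebra R) := LieIdeal {
  lideal_pred :> {pred L};
  lideal_submod : submod_closed lideal_pred;
  lideal_br : forall x y, y \in lideal_pred -> lie_br x y \in lideal_pred
}.

Section LieQuotient.
Variables (R : comNzRingType) (L : lieAlgebra R) (I : lieIdeal L).

HB.instance Definition _ :=
  GRing.isSubmodClosed.Build R L (lideal_pred I) (lideal_submod I).

(* The library provides the additive group of cosets of [I]; the scalar
   multiplication and the bracket are added below. *)
Definition lie_quot_type : Type := @Quotient.quot L (lideal_pred I).

HB.instance Definition _ := GRing.Zmodule.on lie_quot_type.
HB.instance Definition _ : EqQuotient L (Quotient.equiv (lideal_pred I)) lie_quot_type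
  := EqQuotient.on lie_quot_type.

Definition lie_pi (x : L) : lie_quot_type :=
  \pi_(@Quotient.quot L (lideal_pred I)) x.
Definition lie_repr (q : lie_quot_type) : L :=
  repr (q : @Quotient.quot L (lideal_pred I)).

Lemma lie_reprK q : lie_pi (lie_repr q) = q.
Proof. exact: reprK. Qed.

Lemma lie_piP x y : lie_pi x = lie_pi y <-> x - y \in lideal_pred I.
Proof.
rewrite (Quotient.idealrBE (lideal_pred I)).
by split=> [/eqP|/eqP].
Qed.

Lemma lie_piD x y : lie_pi (x + y) = lie_pi x + lie_pi y.
Proof. by rewrite /lie_pi raddfD. Qed.

Definition lie_quot_scale (a : R) (q : lie_quot_type) : lie_quot_type :=
  lie_pi (a *: lie_repr q).

Lemma lie_quot_scale_pi a x : lie_quot_scale a (lie_pi x) = lie_pi (a *: x).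
Proof.
apply/lie_piP; rewrite -scalerBr rpredZ //.
by apply/lie_piP; rewrite lie_reprK.
Qed.

Fact lie_quot_scaleA a b q :
  lie_quot_scale a (lie_quot_scale b q) = lie_quot_scale (a * b) q.
Proof. by rewrite -[q]lie_reprK !lie_quot_scale_pi scalerA. Qed.

Fact lie_quot_scale1 : left_id 1 lie_quot_scale.
Proof. by move=> q; rewrite -[q]lie_reprK lie_quot_scale_pi scale1r. Qed.

Fact lie_quot_scaleDr : right_distributive lie_quot_scale +%R.
Proof.
move=> a p q; rewrite -[p]lie_reprK -[q]lie_reprK -lie_piD.
by rewrite !lie_quot_scale_pi scalerDr lie_piD.
Qed.

Fact lie_quot_scaleDl q :
  {morph lie_quot_scale^~ q : a b / a + b}.
Proof.
move=> a b; rewrite -[q]lie_reprK !lie_quot_scale_pi scalerDl.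
by rewrite lie_piD.
Qed.

HB.instance Definition _ := GRing.Zmodule_isLmodule.Build R lie_quot_type
  lie_quot_scaleA lie_quot_scale1 lie_quot_scaleDr lie_quot_scaleDl.

Lemma lie_piZ (a : R) x : lie_pi (a *: x) = a *: lie_pi x.
Proof. by rewrite -lie_quot_scale_pi. Qed.

Definition lie_quot_br (p q : lie_quot_type) : lie_quot_type :=
  lie_pi (lie_br (lie_repr p) (lie_repr q)).

Lemma lie_quot_br_pi x y :
  lie_quot_br (lie_pi x) (lie_pi y) = lie_pi (lie_br x y).
Proof.
have repr_pi z : exists2 u, u \in lideal_pred I & lie_repr (lie_pi z) = z + u.
  exists (lie_repr (lie_pi z) - z); last by rewrite addrC subrK.
  by apply/lie_piP; rewrite lie_reprK.
have [u Iu eu] := repr_pi x; have [v Iv ev] := repr_pi y.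
apply/lie_piP; rewrite eu ev lie_brDl lie_brDr [_ - lie_br x y]addrC -addrA addKr.
apply: rpredD; first exact: lideal_br.
by rewrite lie_brC rpredN lideal_br.
Qed.

Lemma lie_quot_brP : is_lie_bracket lie_quot_br.
Proof.
split.
- split=> [r a p q|r a p q]; rewrite -[p]lie_reprK -[q]lie_reprK -[r]lie_reprK.
    by rewrite -lie_piZ -lie_piD !lie_quot_br_pi lie_brDl lie_brZl lie_piD lie_piZ.
  by rewrite -lie_piZ -lie_piD !lie_quot_br_pi lie_brDr lie_brZr lie_piD lie_piZ.
- move=> p; rewrite -[p]lie_reprK lie_quot_br_pi (lie_alternating (lie_brP L)).
  exact: raddf0.
- move=> p q r; rewrite -[p]lie_reprK -[q]lie_reprK -[r]lie_reprK.
  rewrite !lie_quot_br_pi -!lie_piD (lie_jacobi (lie_brP L)).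
  exact: raddf0.
Qed.

Definition lie_quot : lieAlgebra R := LieAlgebra lie_quot_brP.

End LieQuotient.

Section Commutator.
Variables (R : comNzRingType) (V : lmodType R) (mul : V -> V -> V).
Hypotheses (mul_bilinear : bilinear_for *:%R *:%R mul) (mulA : associative mul).

Let mulPl z a x y : mul (a *: x + y) z = a *: mul x z + mul y z.
Proof. exact: mul_bilinear.1. Qed.

Let mulPr z a x y : mul z (a *: x + y) = a *: mul z x + mul z y.
Proof. exact: mul_bilinear.2. Qed.

Let mulBl x y z : mul (x - y) z = mul x z - mul y z.
Proof. by rewrite addrC -scaleN1r mulPl scaleN1r addrC. Qed.

Let mulBr x y z : mul z (x - y) = mul z x - mul z y.
Proof. by rewrite addrC -scaleN1r mulPr scaleN1r addrC. Qed.

Lemma commutator_is_lie_bracket :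
  is_lie_bracket (fun x y => mul x y - mul y x).
Proof.
split.
- by split=> [z a x y|z a x y] /=;
    rewrite mulPl mulPr scalerBr opprD [LHS](AC (2*2) ((1*3)*(2*4))).
- by move=> x; rewrite subrr.
- move=> x y z; rewrite !mulBl !mulBr !mulA !opprB !addrA.
  rewrite [LHS](ACl (1*12*2*7*3*10*4*5*6*11*8*9)) /=.
  by rewrite !(subrr, addNr, add0r).
Qed.

End Commutator.

Section GeneralLinear.
Variable R : comNzRingType.

Lemma comp_lfun_bilinear (V : vectType R) :
  bilinear_for *:%R *:%R (fun f g : 'End(V) => (f \o g)%VF).
Proof.
split=> h a f g /=; first by rewrite comp_lfunDl -comp_lfunZl.
by rewrite comp_lfunDr -comp_lfunZr.
Qed.

Definition gl_end (V : vectType R) : lieAlgebra R :=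
  LieAlgebra (commutator_is_lie_bracket (comp_lfun_bilinear V)
                                        (@comp_lfunA _ _ _ _ _)).

Lemma mulmx_bilinear n : bilinear_for *:%R *:%R (@mulmx R n n n).
Proof.
split=> C a A B /=; first by rewrite mulmxDl -scalemxAl.
by rewrite mulmxDr -scalemxAr.
Qed.

Definition gl_mx (n : nat) : lieAlgebra R :=
  LieAlgebra (commutator_is_lie_bracket (mulmx_bilinear n)
                                        (@mulmxA _ _ _ _ _)).
End GeneralLinear.

Section SpecialOrthogonal.
Variables (R : comNzRingType) (n : nat).

Definition skew_mx : {pred gl_mx R n} :=
  [pred A : 'M[R]_n | A^T == - A].

Fact skew_mx_submod : submod_closed skew_mx.
Proof.
split=> [|a A B]; rewrite !inE; first by rewrite trmx0 oppr0.
by move=> /eqP sA /eqP sB; rewrite linearP /= sA sB scalerN opprD.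
Qed.

Fact skew_mx_br : {in skew_mx &, forall A B, lie_br A B \in skew_mx}.
Proof.
move=> A B; rewrite !inE => /eqP sA /eqP sB /=.
by rewrite linearB /= !trmx_mul sA sB !mulNmx !mulmxN !opprK opprB.
Qed.

Definition so : lieAlgebra R :=
  lie_sub (LieSubalgebra skew_mx_submod skew_mx_br).

End SpecialOrthogonal.

Section InnerProduct.
Variables (R : realType) (V : vectType R) (ip : {dot V for idfun}).
Implicit Types x y z : V.

Lemma ipC x y : ip x y = ip y x.
Proof. by rewrite (hermitian_subproof x y) /= expr0 mul1r. Qed.

Lemma ipPr z a x y : ip z (a *: x + y) = a * ip z x + ip z y.
Proof. by rewrite linearPr. Qed.

Lemma ipPl z a x y : ip (a *: x + y) z = a * ip x z + ip y z.
Proof. by rewrite !(ipC _ z) ipPr. Qed.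

Lemma ip0r x : ip x 0 = 0.
Proof. by have := ipPr x (-1) 0 0; rewrite scaler0 addr0 mulN1r addNr. Qed.

Lemma ip0l x : ip 0 x = 0. Proof. by rewrite ipC ip0r. Qed.

Lemma ipBr z x y : ip z (x - y) = ip z x - ip z y.
Proof. by rewrite addrC -scaleN1r ipPr mulN1r addrC. Qed.

Lemma ipBl z x y : ip (x - y) z = ip x z - ip y z.
Proof. by rewrite !(ipC _ z) ipBr. Qed.

Lemma ip_eq0 x : (forall y, ip x y = 0) -> x = 0.
Proof.
move=> x0; apply/eqP/negPn/negP => /(neq0_dnorm_gt0 (s := ip)).
by rewrite x0 ltxx.
Qed.

Lemma ip_inj x y : (forall z, ip x z = ip y z) -> x = y.
Proof.
move=> exy; apply/eqP; rewrite -subr_eq0; apply/eqP/ip_eq0 => z.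
by rewrite ipBl exy subrr.
Qed.

Definition flat (x : V) : 'rV[R]_(\dim {:V}) :=
  \row_i ip x (vbasis {:V})`_i.

Fact flat_linear : linear flat.
Proof. by move=> a x y; apply/rowP=> i; rewrite !mxE ipPl. Qed.

HB.instance Definition _ := GRing.isLinear.Build R V 'rV[R]_(\dim {:V}) _ flat
  flat_linear.

Lemma flatP x y : flat x = flat y -> x = y.
Proof.
move=> exy; apply: ip_inj => z.
rewrite (coord_vbasis (memvf z)).
have ip_sum u : ip u (\sum_i coord (vbasis {:V}) i z *: (vbasis {:V})`_i)
    = \sum_i coord (vbasis {:V}) i z * flat u 0 i.
  have -> : ip u (\sum_i coord (vbasis {:V}) i z *: (vbasis {:V})`_i)
      = \sum_i ip u (coord (vbasis {:V}) i z *: (vbasis {:V})`_i).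
    apply: (big_morph (ip u)) => [v w|]; last exact: ip0r.
    by have := ipPr u 1 v w; rewrite scale1r mul1r.
  by apply: eq_bigr => i _; rewrite mxE -[_ *: _]addr0 ipPr ip0r addr0.
by rewrite !ip_sum exy.
Qed.

Lemma flat_surj w : exists x, flat x = w.
Proof.
have kf : lker (linfun flat) == 0%VS.
  by apply/lker0P => x y; rewrite !lfunE; apply: flatP.
have : limg (linfun flat) == fullv.
  rewrite eqEdim subvf /= limg_dim_eq; last by rewrite (eqP kf) capv0.
  by rewrite !dimvf /dim /= mul1n.
move=> /eqP fl; have /memv_imgP[x _ ->] : w \in limg (linfun flat).
  by rewrite fl memvf.
by exists x; rewrite lfunE.
Qed.

Lemma riesz (phi : V -> R) :
  (forall a x y, phi (a *: x + y) = a * phi x + phi y) ->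
  exists x, forall y, ip x y = phi y.
Proof.
move=> phiP.
have phi0 : phi 0 = 0 by have := phiP (-1) 0 0; rewrite scaler0 addr0 mulN1r addNr.
have [x ex] := flat_surj (\row_i phi (vbasis {:V})`_i); exists x => z.
have sumE (psi : V -> R) :
    (forall a x y, psi (a *: x + y) = a * psi x + psi y) -> psi 0 = 0 ->
    psi z = \sum_i coord (vbasis {:V}) i z * psi (vbasis {:V})`_i.
  move=> psiP psi0; rewrite {1}(coord_vbasis (memvf z)).
  rewrite (big_morph psi (id1 := 0) (op1 := +%R)) //; last first.
    by move=> v w; have := psiP 1 v w; rewrite scale1r mul1r.
  by apply: eq_bigr => i _; rewrite -[_ *: _]addr0 psiP psi0 addr0.
rewrite (sumE phi) // (sumE (ip x)) ?ip0r //; last by move=> *; exact: ipPr.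
apply: eq_bigr => i _; congr (_ * _).
by move/rowP/(_ i): ex; rewrite !mxE.
Qed.

(* Elements of so(V). *)
Definition skew_end (f : 'End(V)) : Prop := forall x y, ip (f x) y = - ip x (f y).

Lemma skew_end0 : skew_end 0.
Proof. by move=> x y; rewrite !lfun_simp ip0l ip0r oppr0. Qed.

Lemma skew_endP a f g : skew_end f -> skew_end g -> skew_end (a *: f + g).
Proof.
by move=> sf sg x y; rewrite !lfun_simp ipPl ipPr sf sg mulrN opprD.
Qed.

Lemma skew_end_br f g : skew_end f -> skew_end g ->
  skew_end (lie_br (f : gl_end V) g).
Proof.
move=> sf sg x y; rewrite /= !lfun_simp.
by rewrite ipBl ipBr (sf (g x)) (sg (f x)) (sg x) (sf x) !opprK opprB.
Qed.

End InnerProduct.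

Section TwoStep.
Variables (R : realType) (n1 n2 : vectType R).
Variables (ip1 : {dot n1 for idfun}) (ip2 : {dot n2 for idfun}).
Variable mu : {bilinear n1 -> n1 -> n2}.

Definition skew_bilinear : Prop := forall X Y, mu X Y = - mu Y X.

(* The unique endomorphism J(Z) of n1 with <J(Z)X, Y> = <mu(X,Y), Z>; see
   [JmuP] and [Jmu_unique]. *)
Definition Jmu (Z : n2) : 'End(n1) :=
  xget 0 [set f : 'End(n1) | forall X Y, ip1 (f X) Y = ip2 (mu X Y) Z]%classic.

Let muPl Y a X X' : mu (a *: X + X') Y = a *: mu X Y + mu X' Y.
Proof. exact: linearPl. Qed.

Let muPr X a Y Y' : mu X (a *: Y + Y') = a *: mu X Y + mu X Y'.
Proof. by rewrite linearPr. Qed.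

Lemma JmuP Z X Y : ip1 (Jmu Z X) Y = ip2 (mu X Y) Z.
Proof.
suff [f fP] : exists f : 'End(n1), forall X Y, ip1 (f X) Y = ip2 (mu X Y) Z.
  by have /= -> := @xgetI _ 0
    [set f : 'End(n1) | forall X Y, ip1 (f X) Y = ip2 (mu X Y) Z]%classic f fP.
have /choice[g gP] : forall X, exists v, forall Y, ip1 v Y = ip2 (mu X Y) Z.
  by move=> U; apply: riesz => a x y; rewrite muPr ipPl.
have g_lin : linear g.
  move=> a x y; apply: (ip_inj (ip := ip1)) => W.
  by rewrite ipPl !gP muPl ipPl.
pose gL : {linear n1 -> n1} :=
  HB.pack g (GRing.isLinear.Build R n1 n1 _ g g_lin).
by exists (linfun gL) => U W; rewrite lfunE /= gP.
Qed.

Lemma Jmu_unique Z (f : 'End(n1)) :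
  (forall X Y, ip1 (f X) Y = ip2 (mu X Y) Z) -> f = Jmu Z.
Proof.
by move=> fP; apply/lfunP => X; apply: (ip_inj (ip := ip1)) => Y;
  rewrite fP JmuP.
Qed.

Lemma Jmu_linear : linear Jmu.
Proof.
move=> a Z W; apply/esym/Jmu_unique => X Y.
by rewrite !lfun_simp ipPl !JmuP ipPr.
Qed.

Lemma Jmu0 : Jmu 0 = 0.
Proof. by apply/esym/Jmu_unique => X Y; rewrite lfun_simp ip0l ip0r. Qed.

Lemma Jmu_skew Z : skew_bilinear -> skew_end ip1 (Jmu Z).
Proof.
move=> sk X Y; rewrite JmuP ipC [RHS]/= (ipC ip1) JmuP sk.
by rewrite -scaleN1r -[_ *: _]addr0 ipPr ip0r addr0 mulN1r ipC.
Qed.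

Definition nonsingular : Prop := forall Z, Z != 0 -> bijective (Jmu Z).

Definition ad_invariant (br : n2 -> n2 -> n2) (ip : n2 -> n2 -> R) : Prop :=
  forall Z U W, ip (br Z U) W = - ip U (br Z W).

(* A finite-dimensional real Lie algebra is (the Lie algebra of a compact Lie
   group, i.e.) compact when it carries some ad-invariant inner product, which
   need not be the inner product [ip2] fixed on n2. *)
Definition compact_lie_bracket (br : n2 -> n2 -> n2) : Prop :=
  is_lie_bracket br /\ exists ip : {dot n2 for idfun}, ad_invariant br ip.

Definition rep_type (br : n2 -> n2 -> n2) : Prop :=
  compact_lie_bracket br /\
  (forall Z W, Jmu (br Z W) = lie_br (Jmu Z : gl_end n1) (Jmu W)).

(* The endomorphism of n1 (+) n2 with block matrix [B, 0; 0, A]. *)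
Definition block_fun (B : 'End(n1)) (A : 'End(n2)) (v : n1 * n2) : n1 * n2 :=
  (B v.1, A v.2).

Fact block_fun_linear B A : linear (block_fun B A).
Proof. by move=> a [x y] [z t]; rewrite /block_fun /= !linearP. Qed.

HB.instance Definition _ B A :=
  GRing.isLinear.Build R (n1 * n2)%type (n1 * n2)%type _ (block_fun B A)
    (block_fun_linear B A).

Definition block_end (B : 'End(n1)) (A : 'End(n2)) : 'End((n1 * n2)%type) :=
  linfun (block_fun B A).

Lemma block_endE B A v : block_end B A v = (B v.1, A v.2).
Proof. by rewrite lfunE. Qed.

Lemma block_end_inj B A B' A' :
  block_end B A = block_end B' A' -> B = B' /\ A = A'.
Proof.
move=> /lfunP e; split; apply/lfunP => x.
  by have := e (x, 0); rewrite !block_endE => -[].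
by have := e (0, x); rewrite !block_endE => -[].
Qed.

Lemma block_end0 : block_end 0 0 = 0.
Proof. by apply/lfunP => v; rewrite block_endE !lfun_simp. Qed.

Lemma block_endP a B A B' A' :
  a *: block_end B A + block_end B' A' = block_end (a *: B + B') (a *: A + A').
Proof. apply/lfunP => v; rewrite add_lfunE scale_lfunE !block_endE.
by rewrite !add_lfunE !scale_lfunE. Qed.

Lemma block_end_br B A B' A' :
  lie_br (block_end B A : gl_end (n1 * n2)%type) (block_end B' A')
    = block_end (lie_br (B : gl_end n1) B') (lie_br (A : gl_end n2) A').
Proof.
apply/lfunP => v; rewrite block_endE /= add_lfunE opp_lfunE !comp_lfunE.
by rewrite !block_endE /= !lfun_simp.
Qed.

Definition kmu_block (B : 'End(n1)) (A : 'End(n2)) : Prop :=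
  [/\ skew_end ip1 B, skew_end ip2 A &
      forall Z, lie_br (B : gl_end n1) (Jmu Z) = Jmu (A Z)].

Definition kmu_pred : {pred gl_end (n1 * n2)%type} :=
  [pred D : 'End((n1 * n2)%type) |
    `[< exists B A, D = block_end B A /\ kmu_block B A >] ].

Lemma kmu_predP (D : 'End((n1 * n2)%type)) :
  reflect (exists B A, D = block_end B A /\ kmu_block B A) (D \in kmu_pred).
Proof. exact: asboolP. Qed.

Fact kmu_submod : submod_closed kmu_pred.
Proof.
split=> [|a _ _ /kmu_predP[B [A [-> [sB sA BA]]]]
              /kmu_predP[B' [A' [-> [sB' sA' BA']]]]]; apply/kmu_predP.
  exists 0, 0; split; first by rewrite block_end0.
  split; [exact: skew_end0|exact: skew_end0|move=> Z].
  by rewrite lie_br0l lfun_simp Jmu0.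
exists (a *: B + B'), (a *: A + A'); split; first by rewrite block_endP.
split; [exact: skew_endP|exact: skew_endP|move=> Z].
have -> : lie_br (a *: B + B' : gl_end n1) (Jmu Z)
    = a *: lie_br (B : gl_end n1) (Jmu Z) + lie_br (B' : gl_end n1) (Jmu Z).
  by rewrite (@lie_brDl _ (gl_end n1)) (@lie_brZl _ (gl_end n1)).
by rewrite BA BA' !lfun_simp Jmu_linear.
Qed.

Fact kmu_br : {in kmu_pred &, forall D E, lie_br D E \in kmu_pred}.
Proof.
move=> _ _ /kmu_predP[B [A [-> [sB sA BA]]]]
           /kmu_predP[B' [A' [-> [sB' sA' BA']]]]; apply/kmu_predP.
exists (lie_br (B : gl_end n1) B'), (lie_br (A : gl_end n2) A').
split; first exact: block_end_br.
split; [exact: skew_end_br|exact: skew_end_br|move=> Z].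
have -> : lie_br (lie_br (B : gl_end n1) B') (Jmu Z) =
    lie_br (B : gl_end n1) (lie_br (B' : gl_end n1) (Jmu Z))
    - lie_br (B' : gl_end n1) (lie_br (B : gl_end n1) (Jmu Z)).
  have := lie_jacobi (lie_brP (gl_end n1)) B B' (Jmu Z).
  rewrite [X in _ + X = _](@lie_brC _ (gl_end n1)) => /eqP.
  rewrite subr_eq0 => /eqP <-; congr (_ + _).
  rewrite [lie_br (Jmu Z : gl_end n1) _](@lie_brC _ (gl_end n1)).
  by rewrite -scaleN1r (@lie_brZr _ (gl_end n1)) scaleN1r.
rewrite BA' BA !BA BA' /= !lfun_simp.
by rewrite [RHS]/= addrC -scaleN1r -Jmu_linear scaleN1r addrC.
Qed.

Definition kmu : lieAlgebra R := lie_sub (LieSubalgebra kmu_submod kmu_br).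

Definition k0mu_pred : {pred kmu} :=
  [pred D : kmu | `[< exists B, lie_subval D = block_end B 0 >] ].

Lemma k0mu_predP (D : kmu) :
  reflect (exists B, lie_subval D = block_end B 0) (D \in k0mu_pred).
Proof. exact: asboolP. Qed.

Fact k0mu_submod : submod_closed k0mu_pred.
Proof.
split=> [|a D E /k0mu_predP[B eB] /k0mu_predP[C eC]]; apply/k0mu_predP.
  by exists 0; rewrite block_end0.
exists (a *: B + C); rewrite /= eB eC block_endP.
by rewrite scaler0 addr0.
Qed.

Fact k0mu_br (D E : kmu) : E \in k0mu_pred -> lie_br D E \in k0mu_pred.
Proof.
move=> /k0mu_predP[B' eE]; apply/k0mu_predP.
have /kmu_predP[B [A [eD _]]] := lie_subvalP D.
exists (lie_br (B : gl_end n1) B').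
rewrite [LHS](_ : _ = lie_br (lie_subval D) (lie_subval E)) // eD eE.
by rewrite block_end_br (@lie_br0r _ (gl_end n2)).
Qed.

Definition k0mu : lieIdeal kmu := LieIdeal k0mu_submod k0mu_br.

End TwoStep.

(* Main.v *)
(* An element of k(mu) acts on n2 by a skew A, and its matrix in an orthonormal
   basis of n2 gives a bracket-preserving map k(mu) -> so(3) with kernel k_0(mu);
   the point is that every skew A occurs.  By ad-invariance the bracket of the
   3-dimensional n2 is c times the cross product.  If c <> 0, then A = ad v for
   some v, and (J(v), A) is in k(mu) because J is a representation.  If c = 0,
   then the J(Z) commute, so J(Z)^-1 J(W) is self-adjoint and, when n1 <> 0, has a
   real eigenvalue a; then J(W - a Z) is singular, against nonsingularity.  Hence
   n1 = 0, and (0, A) is in k(mu). *)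
Require Import Defs.
From HB Require Import structures.
From mathcomp Require Import all_boot all_order all_algebra.
From mathcomp Require Import boolp classical_sets reals.
From mathcomp Require Import ring lra.
From mathcomp.real_closed Require Import complex.

Import Order.TTheory GRing.Theory Num.Theory.
Import passmx.
Local Open Scope ring_scope.

(** * Quotients of Lie algebras *)

Lemma lie_first_isomorphism (R : comNzRingType) (L L' : lieAlgebra R)
    (I : lieIdeal L) (f : L -> L') :
    linear f -> (forall x y, f (lie_br x y) = lie_br (f x) (f y)) ->
    (forall x, x \in lideal_pred I <-> f x = 0) ->
    (forall y, exists x, f x = y) ->
  lie_isomorphic (lie_quot I) L'.
Proof.
move=> f_lin f_br f_ker f_surj.
have fB x y : f (x - y) = f x - f y.
  by rewrite addrC -scaleN1r f_lin scaleN1r addrC.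
(* Left to right this makes [g] below well defined on cosets; right to left it makes [g]
   injective. *)
have f_pi (x y : L) : lie_pi I x = lie_pi I y <-> f x = f y.
  split=> [/lie_piP/f_ker/eqP|e]; first by rewrite fB subr_eq0 => /eqP.
  by apply/lie_piP/f_ker; rewrite fB e subrr.
pose g (q : lie_quot I) : L' := f (lie_repr q).
have g_pi x : g (lie_pi I x) = f x by apply/f_pi; rewrite lie_reprK.
have g_lin : linear g.
  move=> a p q; rewrite -[p]lie_reprK -[q]lie_reprK.
  rewrite [X in g X = _](_ : _ = lie_pi I (a *: lie_repr p + lie_repr q)).
    by rewrite !g_pi f_lin.
  by rewrite lie_piD lie_piZ.
pose gL : {linear lie_quot I -> L'} :=
  HB.pack g (GRing.isLinear.Build R (lie_quot I) L' _ g g_lin).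
(* A section [h] of [f], followed by the projection, is the inverse of [g]. *)
have [h hK] := choice f_surj.
exists gL; split.
  exists (fun y => lie_pi I (h y)) => [q|y] /=; last by rewrite g_pi hK.
  by rewrite -[q]lie_reprK; apply/f_pi; rewrite hK [LHS]g_pi.
move=> p q; rewrite -[p]lie_reprK -[q]lie_reprK.
rewrite /= [lie_quot_br _ _]lie_quot_br_pi.
by rewrite [LHS]g_pi f_br; congr lie_br; rewrite [RHS]g_pi.
Qed.

(** * Orthonormal bases and matrix entries of endomorphisms *)

Section Orthonormal.
Context {R : realType} {V : vectType R} (ip : {dot V for idfun}).

Definition orthonormal_family n (e : 'I_n -> V) : Prop :=
  forall i j, ip (e i) (e j) = (i == j)%:R.

Lemma ipZr (a : R) (x y : V) : ip x (a *: y) = a * ip x y.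
Proof. by rewrite -[a *: y]addr0 ipPr ip0r addr0. Qed.

Lemma ipZl (a : R) (x y : V) : ip (a *: x) y = a * ip x y.
Proof. by rewrite ipC ipZr ipC. Qed.

Lemma ip_suml n (v : V) (a : 'I_n -> R) (e : 'I_n -> V) :
  ip v (\sum_i a i *: e i) = \sum_i a i * ip v (e i).
Proof.
rewrite (big_morph (ip v) (id1 := 0) (op1 := +%R)) ?ip0r //; last first.
  by move=> x y; have := ipPr ip v 1 x y; rewrite scale1r mul1r.
by apply: eq_bigr => i _; rewrite ipZr.
Qed.

Lemma orthonormal_coord n (e : 'I_n -> V) (a : 'I_n -> R) j :
  orthonormal_family n e -> ip (e j) (\sum_i a i *: e i) = a j.
Proof.
move=> on_e; rewrite ip_suml (bigD1 j) //= on_e eqxx mulr1 big1 ?addr0 // => i ij.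
by rewrite on_e eq_sym (negPf ij) mulr0.
Qed.

(** One Gram-Schmidt step: a vector outside the span of the family has a nonzero component [w v]
    orthogonal to it, which is then normalised. *)
Lemma orthonormal_extend n (e : 'I_n -> V) :
  (n < \dim {:V})%N -> orthonormal_family n e ->
  exists e' : 'I_n.+1 -> V, orthonormal_family n.+1 e'.
Proof.
move=> n_lt on_e; pose w v := v - \sum_i ip (e i) v *: e i.
have w_orth v j : ip (e j) (w v) = 0.
  by rewrite ipBr orthonormal_coord // subrr.
(* If [w] vanished everywhere, the [n] vectors [e i] would span [V], against [n < \dim {:V}]. *)
have [v wv] : exists v, w v != 0.
  apply: contrapT => w0; move: n_lt; rewrite ltnNge => /negP; apply.
  have <- : size (codom e) = n by rewrite size_codom card_ord.
  apply: leq_trans (dim_span (codom e)); apply/dimvS/subvP => v _.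
  have : w v == 0 by apply: contrapT => /negP wv; apply: w0; exists v.
  rewrite subr_eq0 => /eqP ->; apply: memv_suml => i _.
  by apply/memvZ/memv_span/codom_f.
have ww_gt0 : 0 < ip (w v) (w v) by exact: neq0_dnorm_gt0.
pose s := Num.sqrt (ip (w v) (w v)).
have s_neq0 : s != 0 by rewrite gt_eqF ?sqrtr_gt0.
pose u := s^-1 *: w v.
have u_orth j : ip (e j) u = 0 by rewrite ipZr w_orth mulr0.
have uu : ip u u = 1.
  rewrite ipZr ipZl.
  rewrite -[ip _ _]sqr_sqrtr ?(ltW ww_gt0) // -/s.
  by rewrite expr2 [X in _ * X]mulrA mulVf // mul1r mulVf.
exists (fun i => if unlift ord_max i is Some j then e j else u) => i j.
case: (unliftP ord_max i) => [i'|] ->; case: (unliftP ord_max j) => [j'|] ->.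
- by rewrite on_e (inj_eq lift_inj).
- by rewrite u_orth eq_sym (negPf (neq_lift _ _)).
- by rewrite ipC u_orth (negPf (neq_lift _ _)).
- by rewrite eqxx.
Qed.

Lemma orthonormal_exists n :
  \dim {:V} = n -> exists e : 'I_n -> V, orthonormal_family n e.
Proof.
move=> <-.
suff H k : (k <= \dim {:V})%N -> exists e, orthonormal_family k e by exact: H.
elim: k => [_|k IH k_lt]; first by exists (fun=> 0) => -[].
by have [e on_e] := IH (ltnW k_lt); apply: orthonormal_extend on_e.
Qed.

Lemma orthonormal_expand n (e : 'I_n -> V) v :
  \dim {:V} = n -> orthonormal_family n e -> v = \sum_i ip (e i) v *: e i.
Proof.
move=> dimV on_e; subst n; pose X := [tuple e i | i < \dim {:V}].
have XE (i : 'I_(\dim {:V})) : X`_i = e i by rewrite -tnth_nth tnth_mktuple.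
have free_X : free X.
  apply/freeP => k; under eq_bigr do rewrite XE.
  by move=> k0 i; rewrite -(orthonormal_coord _ e k i on_e) k0 ip0r.
have X_basis : basis_of fullv X by rewrite basisEfree free_X subvf size_tuple /=.
have := coord_basis X_basis (memvf v); under eq_bigr do rewrite XE.
move=> vE; rewrite {1}vE; apply: eq_bigr => i _.
by rewrite [in RHS]vE orthonormal_coord.
Qed.

(** Expanding both arguments in the basis reduces equality and skewness of endomorphisms to
    conditions on their entries. *)
Lemma orthonormal_end_entries n (e : 'I_n -> V) (A : 'End(V)) x y :
  \dim {:V} = n -> orthonormal_family n e ->
  ip x (A y) = \sum_i \sum_j ip (e i) x * ip (e j) y * ip (e i) (A (e j)).
Proof.
move=> dimV on_e; rewrite ipC {1}(orthonormal_expand _ e x dimV on_e) ip_suml.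
apply: eq_bigr => i _; rewrite {1}(orthonormal_expand _ e y dimV on_e) linear_sum.
under eq_bigr do rewrite linearZ /=.
by rewrite [X in _ * X = _]ipC ip_suml mulr_sumr; apply: eq_bigr => j _; rewrite mulrA.
Qed.

Lemma orthonormal_end_inj n (e : 'I_n -> V) (A B : 'End(V)) :
    \dim {:V} = n -> orthonormal_family n e ->
    (forall i j, ip (e i) (A (e j)) = ip (e i) (B (e j))) ->
  A = B.
Proof.
move=> dimV on_e AB; apply/lfunP => y; apply: (@ip_inj _ _ ip) => x.
rewrite ![ip _ x]ipC !(orthonormal_end_entries _ e _ x y dimV on_e).
by do 2!apply: eq_bigr => ? _; rewrite AB.
Qed.

Lemma orthonormal_end_exists n (e : 'I_n -> V) (M : 'I_n -> 'I_n -> R) :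
  orthonormal_family n e ->
  exists A : 'End(V), forall i j, ip (e i) (A (e j)) = M i j.
Proof.
move=> on_e; pose f x := \sum_i (\sum_j M i j * ip x (e j)) *: e i.
have f_lin : linear f.
  move=> a x y; rewrite scaler_sumr -big_split; apply: eq_bigr => i _ /=.
  rewrite scalerA -scalerDl mulr_sumr -big_split; congr (_ *: _).
  by apply: eq_bigr => j _ /=; rewrite ipPl; ring.
pose fL : {linear V -> V} := HB.pack f (GRing.isLinear.Build R V V _ f f_lin).
exists (linfun fL) => i j; rewrite lfunE /= /f orthonormal_coord //.
rewrite (bigD1 j) //= on_e eqxx mulr1 big1 ?addr0 // => k kj.
by rewrite on_e eq_sym (negPf kj) mulr0.
Qed.

Lemma orthonormal_skew_end n (e : 'I_n -> V) (A : 'End(V)) :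
    \dim {:V} = n -> orthonormal_family n e ->
    (forall i j, ip (e i) (A (e j)) = - ip (e j) (A (e i))) ->
  skew_end ip A.
Proof.
move=> dimV on_e skA x y; rewrite ipC !(orthonormal_end_entries _ e _ _ _ dimV on_e).
rewrite exchange_big -sumrN; apply: eq_bigr => i _; rewrite -sumrN.
by apply: eq_bigr => j _; rewrite skA; ring.
Qed.

(** * Real eigenvectors of self-adjoint maps and commuting skew maps *)

(** Over the algebraically closed field [R[i]] the matrix of [T] has an eigenvector; its real and
    imaginary parts give vectors of [V], not both zero. Symmetry of [T] forces the eigenvalue to be
    real, so a nonzero part is an eigenvector. *)
Lemma self_adjoint_eigenvector (T : 'End(V)) :
    (forall x y, ip (T x) y = ip x (T y)) -> (0 < \dim {:V})%N ->
  exists a x, x != 0 /\ T x = a *: x.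
Proof.
move=> T_sym V_gt0; pose e := vbasis {:V}.
have eb : basis_of fullv e by exact: vbasisP.
pose M := mxof e e T.
have [[a b] /eigenvalueP[v vM v_neq0]] :=
  eigenvalue_closed (map_mx (real_complex R) M) V_gt0.
pose p := map_mx (@complex.Re R) v; pose q := map_mx (@complex.Im R) v.
have vMj j : (\sum_i v 0 i * (real_complex R (M i j))) = Complex a b * v 0 j.
  by move/matrixP/(_ 0 j): vM; rewrite !mxE => <-; under [in RHS]eq_bigr do rewrite mxE.
have pM : p *m M = a *: p - b *: q.
  apply/rowP => j; move/(congr1 (@complex.Re R)): (vMj j).
  rewrite raddf_sum !mxE /=; case: (v 0 j) => v1 v2 /= <-.
  by apply: eq_bigr => i _; rewrite !mxE; case: (v 0 i) => v3 v4 /=; ring.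
have qM : q *m M = a *: q + b *: p.
  apply/rowP => j; move/(congr1 (@complex.Im R)): (vMj j).
  rewrite raddf_sum !mxE /=; case: (v 0 j) => v1 v2 /= <-.
  by apply: eq_bigr => i _; rewrite !mxE; case: (v 0 i) => v3 v4 /=; ring.
(* x + i y is an eigenvector of the complexified T for a + i b; comparing
   <T x, y> with <x, T y> gives b (|x|^2 + |y|^2) = 0. *)
pose x := vecof e p; pose y := vecof e q.
have Tx : T x = a *: x - b *: y.
  by rewrite /x (hom_vecof _ eb) -/M pM linearB !linearZ.
have Ty : T y = a *: y + b *: x.
  by rewrite /y (hom_vecof _ eb) -/M qM linearD !linearZ.
have xy_neq0 : x != 0 \/ y != 0.
  apply/orP; rewrite -negb_and; apply: contra v_neq0.
  rewrite !vecof_eq0 // => /andP[/eqP p0 /eqP q0].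
  apply/eqP/rowP => j; rewrite mxE.
  move/rowP/(_ j): p0; move/rowP/(_ j): q0; rewrite !mxE.
  by case: (v 0 j) => ? ? /= -> ->.
have b0 : b = 0.
  have ip_ge0 u : 0 <= ip u u.
    by case: (eqVneq u 0) => [->|/neq0_dnorm_gt0/ltW//]; rewrite ip0r.
  have : b * (ip x x + ip y y) = 0.
    have := T_sym x y; rewrite Tx Ty ipBl ipPr !ipZl ipZr => e1.
    by rewrite mulrDr; lra.
  move/eqP; rewrite mulf_eq0 paddr_eq0 // => /orP[/eqP //|/andP[xx0 yy0]].
  by case: xy_neq0 => /(neq0_dnorm_gt0 (s := ip)); rewrite lt_neqAle eq_sym ?xx0 ?yy0.
rewrite b0 !scale0r ?subr0 ?addr0 in Tx Ty.
by case: xy_neq0 => ?; [exists a, x|exists a, y].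
Qed.

Lemma commuting_skew_pencil_singular (f g : 'End(V)) :
    skew_end ip f -> skew_end ip g -> bijective f ->
    (forall x, f (g x) = g (f x)) -> (0 < \dim {:V})%N ->
  exists a x, x != 0 /\ g x = a *: f x.
Proof.
move=> skf skg [h fK hK] fg V_gt0.
(* [T = f^-1 g] is self-adjoint: as [f] and [g] commute and are skew, [<g u, f w> = - <u, g (f w)> =
   - <u, f (g w)> = <f u, g w>]. *)
have kf : lker f == 0%VS by apply/lker0P; exact: can_inj fK.
pose T := ((f^-1) \o g)%VF.
have Tf x : T (f x) = g x by rewrite comp_lfunE -fg lker0_lfunK.
have [|a [x [x_neq0 Tx]]] := self_adjoint_eigenvector T _ V_gt0.
  by move=> x y; rewrite -[x]hK -[y]hK !Tf skg -fg -skf.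
(* With [u = f^-1 x], the eigenvalue equation [T x = a x] reads [g u = a (f u)]. *)
exists a, (h x); split; last by rewrite -Tf hK.
by apply: contra_neq x_neq0 => hx0; rewrite -[x]hK hx0 linear0.
Qed.
End Orthonormal.

(** * Alternating tensors in three indices *)

Section Alternating3.
Variables (R : realType) (t : 'I_3 -> 'I_3 -> 'I_3 -> R).
Hypotheses (t12 : forall i j k, t i j k = - t j i k).
Hypotheses (t23 : forall i j k, t i j k = - t i k j).

Let o0 : 'I_3 := ord0.
Let o1 : 'I_3 := lift ord0 ord0.
Let o2 : 'I_3 := lift ord0 (lift ord0 ord0).
Let c := t o0 o1 o2.

Let ord3 (P : 'I_3 -> Prop) : P o0 -> P o1 -> P o2 -> forall i, P i.
Proof.
move=> P0 P1 P2 [[|[|[|i]]] Hi] //.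
- by rewrite (_ : Ordinal Hi = o0) //; apply: val_inj.
- by rewrite (_ : Ordinal Hi = o1) //; apply: val_inj.
- by rewrite (_ : Ordinal Hi = o2) //; apply: val_inj.
Qed.

(** An alternating [t] is [c] times the sign symbol: zero on a repeated index, as here, and [c] or
    [- c] on the six permutations, as in [tc]. *)
Let tE : (forall i k, t i i k = 0) * (forall i k, t i k k = 0)
  * (forall i k, t i k i = 0).
Proof.
have t0 i k : t i i k = 0 by have := t12 i i k; lra.
split=> [|i k]; last by rewrite t23 t0 oppr0.
by split=> // i k; have := t23 i k k; lra.
Qed.

Let tc : (t o0 o1 o2 = c) * (t o1 o0 o2 = - c) * (t o0 o2 o1 = - c)
  * (t o2 o0 o1 = c) * (t o1 o2 o0 = c) * (t o2 o1 o0 = - c).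
Proof.
have h1 := t12 o1 o0 o2; have h2 := t23 o0 o2 o1; have h3 := t12 o2 o0 o1.
have h4 := t23 o1 o2 o0; have h5 := t12 o2 o1 o0.
by rewrite /c; do !split; lra.
Qed.

Lemma alternating3_eq0 : t ord0 (lift ord0 ord0) (lift ord0 (lift ord0 ord0)) = 0 ->
  forall i j k, t i j k = 0.
Proof.
rewrite -/o0 -/o1 -/o2 -/c => c0.
by do 3!elim/ord3; rewrite ?tE // ?tc c0 ?oppr0.
Qed.

(** Contraction with a nonzero volume form identifies R^3 with the skew 3 by 3 matrices. *)
Lemma alternating3_contract (M : 'I_3 -> 'I_3 -> R) :
    t ord0 (lift ord0 ord0) (lift ord0 (lift ord0 ord0)) != 0 ->
    (forall i j, M i j = - M j i) ->
  exists a : 'I_3 -> R, forall i j, \sum_l a l * t l j i = M i j.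
Proof.
rewrite -/o0 -/o1 -/o2 -/c => c_neq0 M_skew.
have M0 i : M i i = 0 by have := M_skew i i; lra.
(* For [(l, j, i)] an even permutation only the term of index [l] survives, so [a l * c = M i j]
   dictates the three values; skewness gives the other entries. *)
exists (fun l =>
  c^-1 * (if l == o0 then M o2 o1 else if l == o1 then M o0 o2 else M o1 o0)).
do 2!elim/ord3; rewrite !big_ord_recl big_ord0 -/o0 -/o1 -/o2 /= ?tE ?tc ?M0;
  rewrite ?(M_skew o0 o1) ?(M_skew o1 o2) ?(M_skew o2 o0); by field.
Qed.
End Alternating3.

(** * Lifting skew endomorphisms of [n2] to k(mu) *)

(** Linear independence of [Z] and [W] is phrased through [W - a *: Z], the vector whose image under
    [Jmu] would be singular if [n1] were nonzero. *)
Lemma nonsingular_commuting_dim0 (R : realType) (n1 n2 : vectType R)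
    (ip1 : {dot n1 for idfun}) (ip2 : {dot n2 for idfun})
    (mu : {bilinear n1 -> n1 -> n2}) (Z W : n2) :
    skew_bilinear mu -> nonsingular ip1 ip2 mu ->
    Z != 0 -> (forall a, W - a *: Z != 0) ->
    (forall X, Jmu ip1 ip2 mu Z (Jmu ip1 ip2 mu W X)
             = Jmu ip1 ip2 mu W (Jmu ip1 ip2 mu Z X)) ->
  \dim {:n1} = 0%N.
Proof.
move=> sk ns Z_neq0 W_indep ZW; apply/eqP; rewrite -leqn0 leqNgt; apply/negP => n1_gt0.
have [a [X [X_neq0 JX]]] := commuting_skew_pencil_singular ip1 _ _
  (Jmu_skew ip1 ip2 Z sk) (Jmu_skew ip1 ip2 W sk) (ns Z Z_neq0) ZW n1_gt0.
have J_inj := bij_inj (ns _ (W_indep a)).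
move/eqP: X_neq0; apply; apply: J_inj; rewrite linear0.
rewrite addrC -scaleNr Jmu_linear add_lfunE scale_lfunE JX.
by rewrite scaleNr addNr.
Qed.

Lemma rep_type_skew_end_lift (R : realType) (n1 n2 : vectType R)
    (dim_n2 : \dim {:n2} = 3%N)
    (ip1 : {dot n1 for idfun}) (ip2 : {dot n2 for idfun})
    (mu : {bilinear n1 -> n1 -> n2}) (mu_skew : skew_bilinear mu)
    (mu_nonsing : nonsingular ip1 ip2 mu)
    (br : n2 -> n2 -> n2) (mu_rep : rep_type ip1 ip2 mu br)
    (ip2_inv : ad_invariant br ip2) (A : 'End(n2)) :
  skew_end ip2 A -> exists B, kmu_block ip1 ip2 mu B A.
Proof.
move=> skA; have [[br_lie _] J_rep] := mu_rep.
pose L := LieAlgebra br_lie.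
have [e on_e] := orthonormal_exists ip2 3 dim_n2.
(* The structure constants in an orthonormal basis are alternating: the first two indices by
   skewness of the bracket, the last two by ad-invariance. *)
pose t i j k := ip2 (e k) (br (e i) (e j)).
have t12 i j k : t i j k = - t j i k.
  by rewrite /t [br (e i) _](@lie_brC _ L) -scaleN1r ipZr mulN1r.
have t23 i j k : t i j k = - t i k j by rewrite /t ipC ip2_inv.
have [t0|t_neq0] := eqVneq (t ord0 (lift ord0 ord0) (lift ord0 (lift ord0 ord0))) 0.
  have br01 : br (e ord0) (e (lift ord0 ord0)) = 0.
    rewrite (orthonormal_expand ip2 _ e (br _ _) dim_n2 on_e) big1 // => i _.
    by rewrite -/(t _ _ i) (alternating3_eq0 _ t t12 t23 t0) scale0r.
  have n1_0 : \dim {:n1} = 0%N.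
    apply: (nonsingular_commuting_dim0 _ _ _ ip1 ip2 mu (e ord0) (e (lift ord0 ord0))) => //.
    - by apply/eqP => e0; have /eqP := on_e ord0 ord0; rewrite e0 ip0l eq_sym oner_eq0.
    - move=> a; apply/eqP => /(congr1 (ip2 (e (lift ord0 ord0)))).
      by rewrite ipBr ipZr !on_e ip0r mulr0 subr0 => /eqP; rewrite oner_eq0.
    - move=> X; have := J_rep (e ord0) (e (lift ord0 ord0)).
      rewrite br01 Jmu0 => /lfunP/(_ X); rewrite !lfun_simp => /esym/eqP.
      by rewrite subr_eq0 => /eqP.
  (* On the zero space any two endomorphisms agree, so [B = 0] satisfies the commutation
     condition. *)
  have n1_triv (x y : n1) : x = y.
    have h (u : n1) : u = 0.
      by apply/eqP; rewrite -memv0 -(eqP (_ : fullv == 0%VS)) ?memvf // -dimv_eq0 n1_0.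
    by rewrite (h x) (h y).
  exists 0; split=> [|//|Z]; first exact: skew_end0.
  by apply/lfunP => x; exact: n1_triv.
(* Since [t l j i] is [<e i, [e l, e j]>], the vector [v] with coordinates [a] satisfies [<e i,
   [v, e j]> = <e i, A (e j)>], that is, [ad v = A]. *)
have [a aP] := alternating3_contract _ t t12 t23 (fun i j => ip2 (e i) (A (e j))) t_neq0
  (fun i j => etrans (ipC ip2 _ _) (skA _ _)).
pose v : n2 := \sum_l a l *: e l.
pose ad : {linear n2 -> n2} :=
  HB.pack (br v) (GRing.isLinear.Build R n2 n2 _ (br v) ((lie_bilinear br_lie).2 v)).
have adE : linfun ad = A.
  apply: (orthonormal_end_inj ip2 _ e _ _ dim_n2 on_e) => i j; rewrite -aP lfunE /= /v.
  rewrite (big_morph (fun x => br x (e j)) (id1 := 0) (op1 := +%R)).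
  - under eq_bigr do rewrite [br _ _](@lie_brZl _ L).
    by rewrite ip_suml.
  - by move=> x y; exact: (@lie_brDl _ L).
  - exact: (@lie_br0l _ L).
exists (Jmu ip1 ip2 mu v); split=> [|//|Z]; first exact: Jmu_skew.
by rewrite -J_rep -adE lfunE.
Qed.

(** * The action of k(mu) on [n2] as a map onto so(3) *)

Theorem proposition5p7 (R : realType) (m : nat) (n1 n2 : vectType R)
    (dim_n1 : \dim {:n1} = m) (dim_n2 : \dim {:n2} = 3%N)
    (ip1 : {dot n1 for idfun}) (ip2 : {dot n2 for idfun})
    (mu : {bilinear n1 -> n1 -> n2}) (mu_skew : skew_bilinear mu)
    (mu_nonsing : nonsingular ip1 ip2 mu)
    (br : n2 -> n2 -> n2) (mu_rep : rep_type ip1 ip2 mu br)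
    (ip2_inv : ad_invariant br ip2) :
  lie_isomorphic (lie_quot (k0mu ip1 ip2 mu)) (so R 3).
Proof.
have [e on_e] := orthonormal_exists ip2 3 dim_n2.
(* Reading the lower block off as [D (0, e j)] avoids choosing [B] and [A] from the existential in
   [kmu_pred]. *)
pose M (D : 'End((n1 * n2)%type)) : 'M[R]_3 :=
  \matrix_(i, j) ip2 (e i) (D (0, e j)).2.
have M_block B A i j : M (block_end B A) i j = ip2 (e i) (A (e j)).
  by rewrite mxE block_endE.
have M_skew (D : kmu ip1 ip2 mu) : M (lie_subval D) \in @skew_mx R 3.
  have /kmu_predP[B [A [-> [_ skA _]]]] := lie_subvalP D.
  by rewrite inE; apply/eqP/matrixP => i j; rewrite [LHS]mxE [RHS]mxE !M_block ipC skA.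
pose f (D : kmu ip1 ip2 mu) : so R 3 :=
  @LieSub _ _ (LieSubalgebra (@skew_mx_submod R 3) (@skew_mx_br R 3)) _ (M_skew D).
apply: (@lie_first_isomorphism _ _ _ _ f).
- move=> a D E; apply: val_inj; apply/matrixP => i j.
  by rewrite !mxE /= !lfun_simp ipPr.
- move=> D E; apply: val_inj => /=.
  have /kmu_predP[B [A [-> _]]] := lie_subvalP D.
  have /kmu_predP[B' [A' [-> _]]] := lie_subvalP E.
  (* Composition of lower blocks becomes the matrix product; [M] does not see the upper block, so 0
     is put there. *)
  have M_mul B1 C1 B2 C2 :
      M (block_end B1 C1) *m M (block_end B2 C2) = M (block_end 0 (C1 \o C2)%VF).
    apply/matrixP => i j; rewrite mxE M_block comp_lfunE.
    rewrite (orthonormal_expand ip2 _ e (C2 (e j)) dim_n2 on_e) linear_sum.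
    under [in RHS]eq_bigr do rewrite linearZ /=.
    rewrite ip_suml; apply: eq_bigr => k _; rewrite !M_block; ring.
  rewrite !M_mul; apply/matrixP => i j.
  by rewrite !mxE add_lfunE opp_lfunE !comp_lfunE !block_endE /= !comp_lfunE ipBr.
(* Kernel: the entries in an orthonormal basis determine [A], so [f D = 0] exactly when the lower
   block vanishes. *)
- move=> D; have /kmu_predP[B [A [eD _]]] := lie_subvalP D.
  split=> [/k0mu_predP[B' eB']|/(congr1 (fun y : so R 3 => lie_subval y : 'M[R]_3)) /= fD0].
    apply: val_inj; apply/matrixP => i j /=.
    by rewrite eB' M_block lfunE /= ip0r mxE.
  apply/k0mu_predP; exists B; rewrite eD; congr block_end.
  apply: (orthonormal_end_inj ip2 _ e _ _ dim_n2 on_e) => i j.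
  move/matrixP/(_ i j): fD0; rewrite eD M_block => ->.
  by rewrite lfunE /= ip0r mxE.
(* Surjectivity: [N] is the matrix of a skew [A], which lifts to an element of k(mu). *)
- move=> [N N_skew]; have /eqP NT : N^T == - N by exact: N_skew.
  have [A AN] := orthonormal_end_exists ip2 _ e N on_e.
  have skA : skew_end ip2 A.
    apply: (orthonormal_skew_end ip2 _ e A dim_n2 on_e) => i j.
    by rewrite !AN; move/matrixP/(_ j i): NT; rewrite !mxE.
  have [B BA] := rep_type_skew_end_lift _ _ _ dim_n2 _ _ _ mu_skew mu_nonsing _ mu_rep ip2_inv A skA.
  have D_in : block_end B A \in kmu_pred ip1 ip2 mu by apply/kmu_predP; exists B, A.
  exists (@LieSub _ _ (LieSubalgebra (@kmu_submod _ _ _ ip1 ip2 mu) (@kmu_br _ _ _ ip1 ip2 mu)) _ D_in).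
  by apply: val_inj; apply/matrixP => i j /=; rewrite M_block AN.
Qed.
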